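(* Let $G$ be a graph on vertex set $\{1,\ldots,n\}$, let $A\in\mathcal{S}(G)$ have the strong spectral property, let $v\in V(G)$, and let $\lambda\in\mathbb{R}$ with $\lambda\notin\operatorname{spec}(A)\cup\operatorname{spec}(A(v))$. Then for every positive integer $s$ there exists a matrix $A'\in\mathcal{S}(G\oplus_v K_{s+1})$ having the strong spectral property such that $\operatorname{spec}(A')=\operatorname{spec}(A)\cup\{\lambda^{(s)}\}$. Moreover, $A'$ can be chosen arbitrarily close to $A\oplus\lambda I_s$ while the $(i,i)$-entry of $A'$ is different from $\lambda$ for every $i\in V(K_{s+1})\setminus\{v\}$.
   Context: For a graph $G$ on $\{1,\ldots,n\}$, $\mathcal{S}(G)$ is the set of $n\times n$ real symmetric matrices $A=(a_{ij})$ with, for $i\neq j$, $a_{ij}\neq0$ iff $\{i,j\}\in E(G)$. A real symmetric matrix $A$ has the strong spectral property if the only real symmetric $X$ with $A\circ X=O$, $I\circ X=O$ and $AX-XA=O$ is $X=O$ ($\circ$ entrywise product). $A(v)$ is the submatrix of $A$ obtained by deleting row and column $v$. $G\oplus_v K_{s+1}$ is the graph obtained from $G$ and a complete graph $K_{s+1}$ by identifying one vertex of $K_{s+1}$ with $v$; its remaining $s$ vertices are labelled $n+1,\ldots,n+s$. $\lambda^{(s)}$ denotes $s$ copies of $\lambda$, and unions of spectra are multiset unions. *)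

(* Defs.v *)
From HB Require Import structures.
From mathcomp Require Import all_boot all_order all_algebra.
From mathcomp Require Import reals.
Set Implicit Arguments. Unset Strict Implicit. Unset Printing Implicit Defensive.
Import Order.TTheory GRing.Theory Num.Theory.
Local Open Scope ring_scope.

Definition simple_graph (n : nat) (G : rel 'I_n) : Prop :=
  (forall i j, G i j = G j i) /\ (forall i, G i i = false).

Definition symmetric_mx (R : realType) (n : nat) (A : 'M[R]_n) : Prop := A^T = A.

Definition in_SG (R : realType) (n : nat) (G : rel 'I_n) (A : 'M[R]_n) : Prop :=
  symmetric_mx A /\ forall i j, i != j -> (A i j != 0) = G i j.

Definition hadamard (R : realType) (n : nat) (A B : 'M[R]_n) : 'M[R]_n :=
  \matrix_(i, j) (A i j * B i j).

Definition SSP (R : realType) (n : nat) (A : 'M[R]_n) : Prop :=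
  forall X : 'M[R]_n, symmetric_mx X ->
    hadamard A X = 0 -> hadamard 1%:M X = 0 -> A *m X - X *m A = 0 -> X = 0.

Definition del_rc (R : realType) (n : nat) (A : 'M[R]_n) (v : 'I_n) : 'M[R]_(n.-1) :=
  row' v (col' v A).

(* G (+)_v K_{s+1}: old vertices are lshift, new vertices n+1..n+s are rshift. *)
Definition vertex_sum_K (n s : nat) (G : rel 'I_n) (v : 'I_n) : rel 'I_(n + s) :=
  fun x y =>
    match split x, split y with
    | inl a, inl b => G a b
    | inl a, inr _ => a == v
    | inr _, inl b => b == v
    | inr a, inr b => a != b
    end.
Arguments vertex_sum_K {n} s G v.

(* Main.v *)
Require Import Defs.
From HB Require Import structures.
From mathcomp Require Import all_boot all_order all_algebra.
From mathcomp Require Import reals.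
From mathcomp Require Import interval_inference boolp classical_sets functions.
From mathcomp Require Import topology normedtype sequences ring lra.
Import Order.TTheory GRing.Theory Num.Theory.
Import numFieldNormedType.Exports.
Local Open Scope ring_scope.

Set Implicit Arguments.
Unset Strict Implicit.
Unset Printing Implicit Defensive.

(** Shift so that the target eigenvalue is 0: [A0 = A - lambda] is invertible,
    and [A0 (+) 0] on [n + 1] vertices still has the strong spectral property.
    That property makes the differential of [Q |-> (Q^T Q, off-pattern part of
    Q (A0 (+) 0) Q^T)] at the identity surjective, so a fixed-point argument
    yields an isospectral [N = [B, tau e_v; tau e_v^T, delta]] close to
    [A0 (+) 0], with [B] in S(G) and [tau <> 0] prescribed. As [N] is singular
    and [B(v)] invertible, [delta <> 0]. For [s] new vertices, conjugate by the
    isometry [C = 1 (+) c], with [c] a unit vector without zero entries: the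
    matrix is [C N C^T + lambda]. *)

(** * Local solvability by contraction *)

(** A solution is a fixed point of [x |-> d - q x], which maps a small closed ball around 0 into
    itself and contracts there by a factor 1/2. *)
Lemma id_plus_quadratic_onto (R : realType) (V : completeNormedModType R)
    (q : V -> V) (C : R) :
  q 0 = 0 ->
  (forall x y, `|q x - q y| <= C * (`|x| + `|y|) * `|x - y|) ->
  forall eps, 0 < eps ->
  exists2 delta, 0 < delta &
    forall d, `|d| < delta -> exists2 x, `|x| <= eps & x + q x = d.
Proof.
move=> q0 qC e e0; pose K := `|C| + 1.
have K0 : 0 < K by rewrite ltr_wpDl.
have {}qC x y : `|q x - q y| <= K * (`|x| + `|y|) * `|x - y|.
  apply: le_trans (qC x y) _; rewrite ler_wpM2r // ler_wpM2r ?addr_ge0 //.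
  by rewrite (le_trans (ler_norm C)) // lerDl.
(* On the ball of radius [r], [q] has Lipschitz constant at most [2 * K * r <= 1/2], and
   [|d - q x| <= r/2 + r/4] keeps the ball stable. *)
pose r := Num.min e (1 / (4 * K)).
have r0 : 0 < r by rewrite lt_min e0 divr_gt0 ?mulr_gt0.
have Kr : K * r <= 1 / 4.
  have : r <= 1 / (4 * K) by rewrite ge_min lexx orbT.
  rewrite -(ler_pM2l K0) => /le_trans; apply.
  by rewrite le_eqVlt; apply/orP; left; apply/eqP; field; rewrite gt_eqF.
exists (r / 2); first by rewrite divr_gt0.
move=> d dr; pose U := closed_ball_ (@Num.norm _ V) 0 r.
have UE x : U x = (`|x| <= r) by rewrite /U /closed_ball_ /= sub0r normrN.
have fU : {homo (fun x => d - q x) : x / U x >-> U x}.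
  move=> x; rewrite !UE => xr.
  rewrite (le_trans (ler_normB _ _)) //.
  have := qC x 0; rewrite q0 normr0 addr0 !subr0 => qx.
  have : K * `|x| * `|x| <= 1 / 4 * r.
    rewrite ler_pM ?mulr_ge0 ?(ltW K0) //.
    by rewrite (le_trans _ Kr) // ler_pM2l.
  by move: dr qx; lra.
have [|||x Ux xE] := @banach_fixed_point _ _ _ (mkfun_fun fU).
  exists ((2^-1 : R)%:nng); split => /=; first lra.
  case=> x y [] /=; rewrite !UE /mkfun => xr yr.
  have -> : d - q x - (d - q y) = q y - q x by rewrite opprB addrC addrA subrK.
  rewrite distrC (le_trans (qC _ _)) // ler_wpM2r //.
  have : K * (`|x| + `|y|) <= K * (r + r) by rewrite ler_pM2l // lerD.
  by move: Kr; lra.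
- exact: closed_closed_ball_.
- by exists 0; rewrite UE normr0 ltW.
exists x; last by rewrite {1}xE /= /mkfun subrK.
by move: Ux; rewrite UE => /le_trans; apply; rewrite ge_min lexx.
Qed.

(** Lets [id_plus_quadratic_onto] be applied to spaces of matrices. *)
HB.instance Definition _ (R : realType) m n := Complete.on 'M[R]_(m, n).

(** * Estimates for the entrywise maximum norm *)

Section MatrixNorm.
Variable R : realType.

Lemma mx_entry_le_norm m n (A : 'M[R]_(m, n)) i j : `|A i j| <= `|A|.
Proof.
rewrite [leRHS]/Num.Def.normr /= mx_normrE.
by apply/bigmax_geP; right; exists (i, j).
Qed.

Lemma mx_norm_le m n (A : 'M[R]_(m, n)) c :
  0 <= c -> (forall i j, `|A i j| <= c) -> `|A| <= c.
Proof.
by move=> c0 Ac; rewrite [leLHS]/Num.Def.normr /= mx_normrE bigmax_le // => -[].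
Qed.

Lemma mx_norm_lt m n (A : 'M[R]_(m, n)) c :
  0 < c -> (forall i j, `|A i j| < c) -> `|A| < c.
Proof.
by move=> c0 Ac; rewrite [ltLHS]/Num.Def.normr /= mx_normrE bigmax_lt // => -[].
Qed.

Lemma mx_norm_mul m n p (A : 'M[R]_(m, n)) (B : 'M_(n, p)) :
  `|A *m B| <= n%:R * `|A| * `|B|.
Proof.
apply: mx_norm_le => [|i j]; first by rewrite !mulr_ge0.
rewrite mxE (le_trans (ler_norm_sum _ _ _)) //.
have -> : n%:R * `|A| * `|B| = \sum_(k < n) `|A| * `|B|.
  by rewrite sumr_const card_ord -mulrA mulr_natl.
by apply: ler_sum => k _; rewrite normrM ler_pM // mx_entry_le_norm.
Qed.

Lemma mx_norm_tr m n (A : 'M[R]_(m, n)) : `|A^T| = `|A|.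
Proof.
have le p q (B : 'M[R]_(p, q)) : `|B^T| <= `|B|.
  by apply: mx_norm_le => // i j; rewrite mxE mx_entry_le_norm.
by apply/eqP; rewrite eq_le le -{1}[A]trmxK le.
Qed.

Lemma mx_linear_bounded m n p q (f : {linear 'M[R]_(m, n) -> 'M[R]_(p, q)}) :
  exists2 C, 0 <= C & forall x, `|f x| <= C * `|x|.
Proof.
exists (\sum_i \sum_j `|f (delta_mx i j)|).
  by rewrite sumr_ge0 // => i _; rewrite sumr_ge0.
move=> x; rewrite {1}[x]matrix_sum_delta linear_sum mulr_suml.
rewrite (le_trans (ler_norm_sum _ _ _)) //; apply: ler_sum => i _.
rewrite linear_sum mulr_suml (le_trans (ler_norm_sum _ _ _)) //.
apply: ler_sum => j _.
by rewrite linearZ normrZ mulrC ler_wpM2l // mx_entry_le_norm.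
Qed.

(** A row [u] killed by [B + E] satisfies [u = - u E B^-1]; for small [E] this makes [u] shorter
    than itself unless it is 0. *)
Lemma unitmx_near n (B : 'M[R]_n) : B \in unitmx ->
  exists2 delta, 0 < delta & forall E, `|E| < delta -> B + E \in unitmx.
Proof.
move=> uB; pose K := n%:R * `|invmx B| * n%:R + 1.
have K0 : 0 < K by rewrite ltr_wpDl // !mulr_ge0.
exists K^-1 => [|E EK]; first by rewrite invr_gt0.
rewrite -row_free_unit -kermx_eq0; apply/eqP/row_matrixP => i.
rewrite row0; set u := row i _.
have : u *m (B + E) = 0 by apply/sub_kermxP; rewrite row_sub.
rewrite mulmxDr => /eqP; rewrite addr_eq0 => /eqP uBE.
have uE : u = - (u *m E *m invmx B) by rewrite -mulNmx -uBE mulmxK.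
have [//|u0] := eqVneq u 0.
have nu0 : 0 < `|u| by rewrite normr_gt0.
have : `|u| < `|u|.
  rewrite {1}uE normrN (le_lt_trans (mx_norm_mul _ _)) //.
  apply: (@le_lt_trans _ _ (`|E| * K * `|u|)).
    apply: (@le_trans _ _ (n%:R * (n%:R * `|u| * `|E|) * `|invmx B|)).
      by rewrite ler_wpM2r // ler_wpM2l // mx_norm_mul.
    have -> : n%:R * (n%:R * `|u| * `|E|) * `|invmx B|
       = `|E| * (n%:R * `|invmx B| * n%:R) * `|u| by ring.
    by rewrite ler_wpM2r // ler_wpM2l // lerDl.
  by rewrite gtr_pMl // -ltr_pdivlMr // div1r.
by rewrite ltxx.
Qed.

End MatrixNorm.

(** * Trace form, masks and symmetric parts *)

Lemma frobenius_eq0 (R : realType) m n (x : 'M[R]_(m, n)) :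
  \tr (x^T *m x) = 0 -> x = 0.
Proof.
rewrite /mxtrace => h; apply/matrixP => i j; rewrite mxE.
have sq k : (x^T *m x) k k = \sum_l x l k ^+ 2.
  by rewrite mxE; apply: eq_bigr => l _; rewrite mxE expr2.
have ge0 k : 0 <= (x^T *m x) k k.
  by rewrite sq sumr_ge0 // => l _; rewrite sqr_ge0.
have /eqP := h; rewrite psumr_eq0 // => /allP /(_ j).
rewrite mem_index_enum => /(_ isT) /=.
rewrite sq psumr_eq0 => [|l _]; last exact: sqr_ge0.
move=> /allP /(_ i); rewrite mem_index_enum => /(_ isT) /=.
by rewrite sqrf_eq0 => /eqP.
Qed.

Definition mxmask (R : realType) n (P : rel 'I_n) (A : 'M[R]_n) : 'M[R]_n :=
  \matrix_(i, j) (if P i j then A i j else 0).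

Fact mxmask_is_linear (R : realType) n (P : rel 'I_n) : linear (@mxmask R n P).
Proof.
move=> a A B; apply/matrixP => i j; rewrite !mxE.
by case: (P i j); rewrite ?mulr0 ?addr0.
Qed.
HB.instance Definition _ (R : realType) n (P : rel 'I_n) :=
  GRing.isLinear.Build R 'M[R]_n 'M[R]_n _ (@mxmask R n P) (mxmask_is_linear P).

Definition symm (R : realType) n (A : 'M[R]_n) : 'M[R]_n := 2^-1 *: (A + A^T).

Fact symm_is_linear (R : realType) n : linear (@symm R n).
Proof. by move=> a A B; apply/matrixP => i j; rewrite !mxE; ring. Qed.
HB.instance Definition _ (R : realType) n :=
  GRing.isLinear.Build R 'M[R]_n 'M[R]_n _ (@symm R n) (@symm_is_linear R n).

Section Masks.
Variables (R : realType) (n : nat) (P : rel 'I_n).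
Implicit Types A B X : 'M[R]_n.

Lemma mxmaskK A : mxmask P (mxmask P A) = mxmask P A.
Proof. by apply/matrixP => i j; rewrite !mxE; case: (P i j). Qed.

Lemma mxmask_norm A : `|mxmask P A| <= `|A|.
Proof.
apply: mx_norm_le => // i j; rewrite mxE.
by case: (P i j); rewrite ?normr0 // mx_entry_le_norm.
Qed.

Lemma symm_tr A : (symm A)^T = symm A.
Proof. by apply/matrixP => i j; rewrite !mxE addrC. Qed.

Lemma symm_id A : A^T = A -> symm A = A.
Proof. by move=> At; rewrite /symm At; apply/matrixP => i j; rewrite !mxE; lra. Qed.

Hypothesis Psym : forall i j, P i j = P j i.

Lemma mxmask_tr A : (mxmask P A)^T = mxmask P A^T.
Proof. by apply/matrixP => i j; rewrite !mxE Psym. Qed.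

Lemma tr_mxmask X A : mxmask P X = X -> mxmask P A = 0 -> \tr (X *m A) = 0.
Proof.
move=> PX PA; apply: big1 => i _; rewrite mxE; apply: big1 => j _.
have /matrixP/(_ i j) := PX; have /matrixP/(_ j i) := PA; rewrite !mxE Psym.
by case: (P i j) => [-> _|_ <-]; rewrite ?mulr0 ?mul0r.
Qed.

End Masks.

(** * Isospectral perturbation under a strong spectral property *)

(** [P] marks where [X] may be nonzero. Fixing it independently of the zeros of [M] makes the
    condition stable under small symmetric perturbations, even those creating nonzero entries inside
    [P]. *)
Definition pattern_SSP (R : realType) n (P : rel 'I_n) (M : 'M[R]_n) : Prop :=
  forall X : 'M[R]_n, X^T = X -> mxmask P X = X -> M *m X = X *m M -> X = 0.

Section Perturbation.
Variables (R : realType) (n : nat) (P : rel 'I_n) (M : 'M[R]_n).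
Hypotheses (Psym : forall i j, P i j = P j i) (Msym : M^T = M).
Hypothesis Mssp : pattern_SSP P M.
Implicit Types (w : 'M[R]_(n, n + n)) (x y : 'M[R]_n).

(* For [Q = 1 + x], the equations [Q^T Q = 1] and [mxmask P (Q M Q^T - M) = D] read
   [dif x + quad x = row_mx 0 D]. They are solved with [x] in the range of the
   adjoint of [dif]; [K] extends [dif \o adj] by the identity on [lker proj]. *)
Let sympart w := symm (lsubmx w).
Let offpart w := mxmask P (symm (rsubmx w)).
Let adj w := sympart w + offpart w *m M.
Let dif x := row_mx (x + x^T) (mxmask P (x *m M + M *m x^T)).
Let quad x := row_mx (x^T *m x) (mxmask P (x *m M *m x^T)).
Let proj w := row_mx (sympart w) (offpart w).
Let K w := dif (adj w) + (w - proj w).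

Let sympart_tr w : (sympart w)^T = sympart w. Proof. exact: symm_tr. Qed.
Let offpart_tr w : (offpart w)^T = offpart w.
Proof. by rewrite mxmask_tr // symm_tr. Qed.

Let sympartP a u v : sympart (a *: u + v) = a *: sympart u + sympart v.
Proof. by rewrite /sympart linearP linearP. Qed.
Let offpartP a u v : offpart (a *: u + v) = a *: offpart u + offpart v.
Proof. by rewrite /offpart linearP linearP linearP. Qed.

Fact adj_is_linear : linear adj.
Proof.
move=> a u v; rewrite /adj sympartP offpartP mulmxDl -scalemxAl.
by rewrite [in RHS]scalerDr addrACA.
Qed.

Fact dif_is_linear : linear dif.
Proof.
move=> a u v; rewrite /dif scale_row_mx add_row_mx; congr row_mx.
  by rewrite linearP /= scalerDr addrACA.
rewrite -linearP /=; congr mxmask; rewrite linearP /= mulmxDl mulmxDr.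
by rewrite -scalemxAl -scalemxAr scalerDr addrACA.
Qed.

HB.instance Definition _ := GRing.isLinear.Build R _ _ _ adj adj_is_linear.
HB.instance Definition _ := GRing.isLinear.Build R _ _ _ dif dif_is_linear.

Fact proj_is_linear : linear proj.
Proof.
move=> a u v; rewrite /proj scale_row_mx add_row_mx.
by rewrite sympartP offpartP.
Qed.
HB.instance Definition _ := GRing.isLinear.Build R _ _ _ proj proj_is_linear.

Fact K_is_linear : linear K.
Proof.
move=> a u v; rewrite /K adj_is_linear dif_is_linear proj_is_linear.
rewrite [in RHS]scalerDr [RHS]addrACA; congr (_ + _).
by rewrite scalerBr opprD addrACA.
Qed.
HB.instance Definition _ := GRing.isLinear.Build R _ _ _ K K_is_linear.

Lemma proj_row S X : S^T = S -> X^T = X -> mxmask P X = X ->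
  proj (row_mx S X) = row_mx S X.
Proof.
move=> St Xt PX; rewrite /proj /sympart /offpart row_mxKl row_mxKr.
by rewrite !symm_id ?PX.
Qed.

(** With [proj_quad], this places both sides of the system in the range of [proj], so projecting a
    solved equation removes the auxiliary summand [w - proj w] of [K]. *)
Lemma proj_dif x : proj (dif x) = dif x.
Proof.
apply: proj_row; rewrite ?mxmaskK //.
  by rewrite linearD /= trmxK addrC.
by rewrite mxmask_tr // linearD /= !trmx_mul trmxK Msym addrC.
Qed.

Lemma proj_quad x : proj (quad x) = quad x.
Proof.
apply: proj_row; rewrite ?mxmaskK //; first by rewrite trmx_mul trmxK.
by rewrite mxmask_tr // !trmx_mul trmxK Msym mulmxA.
Qed.

Lemma projK w : proj (proj w) = proj w.
Proof. by apply: proj_row; rewrite ?sympart_tr ?offpart_tr // /offpart mxmaskK. Qed.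

Let proj_K w : proj (K w) = dif (adj w).
Proof.
have projD u v : proj (u + v) = proj u + proj v by exact: linearD.
have projB u v : proj (u - v) = proj u - proj v by exact: linearB.
by rewrite /K projD projB projK subrr addr0 proj_dif.
Qed.

(* [dif] and [adj] are adjoint up to a factor, so [dif \o adj] has the kernel of [adj]. *)
Lemma dif_adj_eq0 w : dif (adj w) = 0 -> adj w = 0.
Proof.
set x := adj w; rewrite -[0]row_mx0 => /eq_row_mx[/eqP xx0 Px0].
have xt : x^T = - x by apply/eqP; rewrite -addr_eq0 addrC.
apply: frobenius_eq0; rewrite {2}/x /adj mulmxDr linearD /=.
(* A skew matrix is orthogonal to a symmetric one for the trace form. *)
have -> : \tr (x^T *m sympart w) = 0.
  have : \tr (x^T *m sympart w) = - \tr (x^T *m sympart w).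
    rewrite -{1}mxtrace_tr trmx_mul trmxK sympart_tr mxtrace_mulC xt.
    by rewrite mulNmx linearN opprK.
  lra.
(* [offpart w] is supported on [P], where [x M + M x^T] vanishes. The two resulting traces are equal
   with sum 0, so each is 0. *)
have := tr_mxmask Psym (mxmaskK P (symm (rsubmx w))) Px0.
rewrite -/(offpart w) mulmxDr linearD /= add0r.
have -> : \tr (offpart w *m (x *m M)) = \tr (x^T *m (offpart w *m M)).
  rewrite -mxtrace_tr !trmx_mul Msym offpart_tr.
  by rewrite -mulmxA mxtrace_mulC -mulmxA.
have -> : \tr (offpart w *m (M *m x^T)) = \tr (x^T *m (offpart w *m M)).
  by rewrite mulmxA mxtrace_mulC.
lra.
Qed.

(** Projecting [K w = 0] gives [adj w = 0], and then [w = proj w] is a pair [(S, X)] with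
    [S = - X M]. As [S] is symmetric, [X] commutes with [M], so [Mssp] kills [X] and hence [S]. *)
Lemma K_inj w : K w = 0 -> w = 0.
Proof.
move=> Kw; have : proj (K w) = 0 by rewrite Kw linear0.
rewrite proj_K => dw.
have aw := dif_adj_eq0 dw.
have pw : w = proj w by move: Kw; rewrite /K dw add0r => /subr0_eq.
suff X0 : offpart w = 0.
  move: aw; rewrite /adj X0 mul0mx addr0 => S0.
  by rewrite pw /proj X0 S0 row_mx0.
apply: Mssp; rewrite ?offpart_tr // ?mxmaskK //.
have /eqP : sympart w + offpart w *m M = 0 by exact: aw.
rewrite addrC addr_eq0 => /eqP XM.
by rewrite XM -[M]Msym -offpart_tr -trmx_mul XM linearN /= sympart_tr.
Qed.


Lemma K_inverse : exists2 Kinv : {linear 'M[R]_(n, n + n) -> 'M[R]_(n, n + n)},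
  cancel K Kinv & cancel Kinv K.
Proof.
have kK : lker (linfun K) == 0%VS.
  apply/lker0P => u v; rewrite !lfunE /= => Kuv; apply/eqP; rewrite -subr_eq0.
  by apply/eqP/K_inj; rewrite linearB /= Kuv subrr.
exists (linfun K)^-1%VF => w.
  by have := lker0_lfunK kK w; rewrite lfunE.
by have := lker0_lfunVK kK w; rewrite lfunE.
Qed.

Lemma row_mx_norm (A B : 'M[R]_n) : `|row_mx A B| <= `|A| + `|B|.
Proof.
apply: mx_norm_le => [|i j]; first by rewrite addr_ge0.
rewrite mxE; case: (fintype.split j) => k.
  by rewrite (le_trans (mx_entry_le_norm _ _ _)) // lerDl.
by rewrite (le_trans (mx_entry_le_norm _ _ _)) // lerDr.
Qed.

Lemma quad_lipschitz : exists2 C, 0 <= C & forall x y,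
  `|quad x - quad y| <= C * (`|x| + `|y|) * `|x - y|.
Proof.
exists (n%:R + n%:R ^+ 2 * `|M|) => [|x y].
  by rewrite addr_ge0 ?mulr_ge0 ?exprn_ge0.
(* Each difference of products is telescoped so that every term contains the factor [x - y] once. *)
have -> : quad x - quad y = row_mx (x^T *m (x - y) + (x - y)^T *m y)
    (mxmask P (x *m M *m (x - y)^T + (x - y) *m M *m y^T)).
  rewrite /quad opp_row_mx add_row_mx -linearB /=; congr (row_mx _ (mxmask _ _)).
    by rewrite mulmxBr linearB /= mulmxBl addrA subrK.
  by rewrite linearB /= mulmxBr !mulmxBl addrA subrK.
apply: le_trans (row_mx_norm _ _) _.
rewrite [leRHS](_ : _ = (n%:R * `|x| * `|x - y| + n%:R * `|x - y| * `|y|)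
  + (n%:R * (n%:R * `|x| * `|M|) * `|x - y|
     + n%:R * (n%:R * `|x - y| * `|M|) * `|y|)); last by ring.
apply: lerD.
  rewrite (le_trans (ler_normD _ _)) // lerD //.
    by rewrite (le_trans (mx_norm_mul _ _)) // mx_norm_tr.
  by rewrite (le_trans (mx_norm_mul _ _)) // mx_norm_tr.
rewrite (le_trans (mxmask_norm _ _)) // (le_trans (ler_normD _ _)) // lerD //.
  rewrite (le_trans (mx_norm_mul _ _)) // mx_norm_tr.
  by rewrite ler_wpM2r // ler_wpM2l // mx_norm_mul.
rewrite (le_trans (mx_norm_mul _ _)) // mx_norm_tr.
by rewrite ler_wpM2r // ler_wpM2l // mx_norm_mul.
Qed.

(** With [x = adj w], solve [K w + quad (adj w) = row_mx 0 D] after composing with [Kinv], which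
    turns it into identity plus a quadratic map; applying [proj] then recovers the system. *)
Lemma quadratic_system_solvable eps : 0 < eps ->
  exists2 delta, 0 < delta & forall D : 'M[R]_n, D^T = D -> mxmask P D = D ->
    `|D| < delta -> exists x : 'M[R]_n,
    [/\ `|x| <= eps, x + x^T + x^T *m x = 0 &
        mxmask P (x *m M + M *m x^T + x *m M *m x^T) = D].
Proof.
move=> e0.
have [Kinv KK KinvK] := K_inverse.
have [Ca Ca0 adj_le] := mx_linear_bounded adj.
have [Ci Ci0 Kinv_le] := mx_linear_bounded Kinv.
have [Cq Cq0 quad_le] := quad_lipschitz.
pose q w := Kinv (quad (adj w)).
have q0 : q 0 = 0.
  rewrite /q linear0 /quad trmx0 !mulmx0 linear0 row_mx0.
  exact: linear0.
have qC u v : `|q u - q v| <= Ci * Cq * Ca * Ca * (`|u| + `|v|) * `|u - v|.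
  rewrite /q -linearB (le_trans (Kinv_le _)) //.
  rewrite -!(mulrA Ci) ler_wpM2l // (le_trans (quad_le _ _)) // -linearB.
  have -> : Cq * Ca * Ca * (`|u| + `|v|) * `|u - v| =
            Cq * (Ca * `|u| + Ca * `|v|) * (Ca * `|u - v|) by ring.
  by rewrite ler_pM ?mulr_ge0 ?addr_ge0 // ler_wpM2l // lerD.
(* The bounds [Ca] and [Ci] may be 0, hence the added 1 in the denominators. *)
have e'0 : 0 < eps / (Ca + 1) by rewrite divr_gt0 // ltr_wpDl.
have [d d0 solve] := id_plus_quadratic_onto q0 qC e'0.
exists (d / (Ci + 1)) => [|D Dt PD Dd]; first by rewrite divr_gt0 // ltr_wpDl.
have [w we wE] : exists2 w, `|w| <= eps / (Ca + 1) & w + q w = Kinv (row_mx 0 D).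
  apply: solve; rewrite (le_lt_trans (Kinv_le _)) //.
  move: Dd; rewrite ltr_pdivlMr ?ltr_wpDl // mulrC; apply: le_lt_trans.
  rewrite ler_pM // ?lerDl //.
  by rewrite (le_trans (row_mx_norm _ _)) // normr0 add0r.
have {}wE : K w + quad (adj w) = row_mx 0 D.
  by rewrite -[RHS]KinvK -wE linearD /= /q KinvK.
have : proj (K w + quad (adj w)) = row_mx 0 D by rewrite wE proj_row ?trmx0.
have -> : proj (K w + quad (adj w)) = proj (K w) + proj (quad (adj w)).
  exact: linearD.
rewrite proj_K proj_quad.
rewrite add_row_mx -linearD => /eq_row_mx[e1 e2]; exists (adj w); split=> //.
rewrite (le_trans (adj_le w)) //.
move: we; rewrite ler_pdivlMr ?ltr_wpDl // mulrC; apply: le_trans.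
by rewrite ler_wpM2r // lerDl.
Qed.

(* For [X] commuting with [M'], [adj] sends the pair [(- X M', X)] to [X (M - M')], which is
   small, contradicting that [K] is bounded below unless [X = 0]. *)
Lemma pattern_SSP_near : exists2 eta, 0 < eta & forall M' : 'M[R]_n,
  M'^T = M' -> `|M' - M| < eta -> pattern_SSP P M'.
Proof.
have [Kinv KK KinvK] := K_inverse.
have [Ci Ci0 Kinv_le] := mx_linear_bounded Kinv.
have [Cd Cd0 dif_le] := mx_linear_bounded dif.
pose C := Ci * Cd * n%:R + 1.
have C0 : 0 < C by rewrite ltr_wpDl ?mulr_ge0.
exists C^-1 => [|M' M't M'M X Xt PX M'X]; first by rewrite invr_gt0.
have [//|X0] := eqVneq X 0.
have nX : 0 < `|X| by rewrite normr_gt0.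
pose w := row_mx (- (X *m M')) X.
have pw : proj w = w.
  by apply: proj_row => //; rewrite linearN /= trmx_mul M't Xt M'X.
have Kw : K w = dif (X *m (M - M')).
  rewrite /K pw subrr addr0; congr dif.
  have := pw; rewrite {1}/proj => /eq_row_mx[].
  by rewrite /adj => -> ->; rewrite mulmxBr addrC.
have : `|w| <= Ci * (Cd * (n%:R * `|X| * `|M - M'|)).
  rewrite -{1}[w]KK (le_trans (Kinv_le _)) // ler_wpM2l // Kw.
  by rewrite (le_trans (dif_le _)) // ler_wpM2l // mx_norm_mul.
have Xw : `|X| <= `|w|.
  apply: mx_norm_le => // i j.
  rewrite -(row_mxEr (- (X *m M')) X); exact: mx_entry_le_norm.
move=> /(le_trans Xw); suff : Ci * (Cd * (n%:R * `|X| * `|M - M'|)) < `|X|.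
  by move=> /[swap] /le_lt_trans /[apply]; rewrite ltxx.
have -> : Ci * (Cd * (n%:R * `|X| * `|M - M'|)) =
  Ci * Cd * n%:R * `|M - M'| * `|X| by ring.
rewrite gtr_pMl // distrC; move: M'M; rewrite -[_^-1]div1r ltr_pdivlMr // mulrC.
by apply: le_lt_trans; rewrite ler_wpM2r // lerDl.
Qed.

End Perturbation.

Lemma isospectral_perturbation (R : realType) n (P : rel 'I_n) (M : 'M[R]_n) :
  (forall i j, P i j = P j i) -> M^T = M -> pattern_SSP P M ->
  forall eps, 0 < eps -> exists2 delta, 0 < delta &
  forall D : 'M[R]_n, D^T = D -> mxmask P D = D -> `|D| < delta ->
  exists Q : 'M[R]_n, [/\ Q^T *m Q = 1%:M, `|Q *m M *m Q^T - M| < eps,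
    mxmask P (Q *m M *m Q^T) = mxmask P M + D & pattern_SSP P (Q *m M *m Q^T)].
Proof.
move=> Psym Mt Mssp eps e0.
have [eta eta0 near_ssp] := pattern_SSP_near Psym Mt Mssp.
(* For [|x| <= 1], [x M + M x^T + x M x^T] has norm at most [C * |x|]. The cap 1 in [r] makes the
   quadratic term linear in [|x|], and the factor 2 yields strict bounds. *)
pose C := 2 * n%:R * `|M| + n%:R ^+ 2 * `|M| + 1.
have C0 : 0 < C by rewrite ltr_wpDl // addr_ge0 ?mulr_ge0 ?exprn_ge0.
pose r := Num.min 1 (Num.min eps eta / (2 * C)).
have m0 : 0 < Num.min eps eta by rewrite lt_min e0.
have r0 : 0 < r by rewrite lt_min ltr01 divr_gt0 ?mulr_gt0.
have [d d0 solve] := quadratic_system_solvable Psym Mt Mssp r0.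
exists d => // D Dt PD Dd; have [x [xr orth PE]] := solve D Dt PD Dd.
have QE : (1%:M + x) *m M *m (1%:M + x)^T
    = M + (x *m M + M *m x^T + x *m M *m x^T).
  rewrite linearD /= trmx1 mulmxDl mul1mx !mulmxDr !mulmxDl !mulmx1.
  by rewrite !addrA.
have dist : `|(1%:M + x) *m M *m (1%:M + x)^T - M| < Num.min eps eta.
  rewrite QE addrC addKr.
  have x1 : `|x| <= 1 by rewrite (le_trans xr) // ge_min lexx.
  have xC : `|x| <= Num.min eps eta / (2 * C).
    by rewrite (le_trans xr) // ge_min lexx orbT.
  apply: (@le_lt_trans _ _ (C * `|x|)); last first.
    move: xC; rewrite ler_pdivlMr ?mulr_gt0 // mulrC -mulrA.
    move: m0; set m := Num.min eps eta; lra.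
  have b1 : `|x *m M| <= n%:R * `|x| * `|M| by exact: mx_norm_mul.
  have b2 : `|M *m x^T| <= n%:R * `|M| * `|x|.
    by rewrite -[in leRHS](mx_norm_tr x) mx_norm_mul.
  have b3 : `|x *m M *m x^T| <= n%:R ^+ 2 * `|M| * `|x|.
    rewrite (le_trans (mx_norm_mul _ _)) // mx_norm_tr ler_wpM2r //.
    rewrite expr2 -mulrA ler_wpM2l // (le_trans b1) // ler_wpM2r //.
    by rewrite ler_piMr.
  rewrite (le_trans (ler_normD _ _)) // (le_trans (lerD (ler_normD _ _) (lexx _))) //.
  rewrite (le_trans (lerD (lerD b1 b2) b3)) // /C.
  rewrite !mulrDl mul1r -subr_ge0.
  by rewrite (_ : _ - _ = `|x|) //; ring.
exists (1%:M + x); split.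
- rewrite [(_ + _)^T]linearD /= trmx1 mulmxDl mul1mx mulmxDr mulmx1 -addrA.
  by rewrite -[RHS]addr0 -orth -!addrA.
- by rewrite (lt_le_trans dist) // ge_min lexx.
- by rewrite QE linearD /= PE.
- apply: near_ssp; last by rewrite (lt_le_trans dist) // ge_min lexx orbT.
  by rewrite !trmx_mul trmxK Mt mulmxA.
Qed.

(** * Characteristic polynomials and isometries *)

(** Sylvester's determinant identity in a division-free form, valid over polynomials: multiplying
    [T] by two block triangular matrices computes its determinant in two ways. *)
Lemma det_scalar_sub_mulC (S : comNzRingType) m n (mu : S)
    (C : 'M[S]_(m, n)) (D : 'M[S]_(n, m)) :
  mu ^+ n * \det (mu%:M - C *m D) = mu ^+ m * \det (mu%:M - D *m C).
Proof.
pose T := block_mx mu%:M C D 1%:M.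
have : \det (T *m block_mx 1%:M 0 (- D) 1%:M) = \det (mu%:M - C *m D).
  rewrite mulmx_block !mulmx1 !mulmx0 !mul1mx !add0r subrr mulmxN.
  by rewrite det_ublock det1 mulr1.
rewrite det_mulmx det_lblock !det1 !mulr1 => <-.
have : \det (block_mx 1%:M 0 (- D) mu%:M *m T) = mu ^+ m * \det (mu%:M - D *m C).
  rewrite mulmx_block !mul1mx !mul0mx !addr0 mulmx1 !mulNmx.
  rewrite scalar_mxC addNr det_ublock det_scalar.
  by rewrite [- _ + _]addrC.
by rewrite det_mulmx det_lblock det1 mul1r det_scalar.
Qed.

(** Sylvester's identity at [mu = 'X - lambda], with factors [V (A - lambda)] and [V^T]; cancelling
    [mu ^+ n] leaves the surplus [mu ^+ s]. *)
Lemma char_poly_isometry (F : fieldType) n s (A : 'M[F]_n) (lambda : F)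
    (V : 'M[F]_(n + s, n)) : V^T *m V = 1%:M ->
  char_poly (V *m (A - lambda%:M) *m V^T + lambda%:M)
  = char_poly A * ('X - lambda%:P) ^+ s.
Proof.
move=> VV; set A0 := A - lambda%:M; pose mu : {poly F} := 'X - lambda%:P.
have mu0 : mu != 0 by rewrite polyXsubC_eq0.
have E k (B : 'M[F]_k) :
    char_poly_mx (B + lambda%:M) = mu%:M - map_mx polyC B.
  by rewrite /char_poly_mx map_mxD map_scalar_mx opprD addrCA addrC raddfB addrAC.
have := det_scalar_sub_mulC mu (map_mx polyC (V *m A0)) (map_mx polyC V^T).
rewrite -!map_mxM -!E mulmxA VV mul1mx subrK -!/(char_poly _) exprD -mulrA.
move=> /(mulfI (expf_neq0 _ mu0)) ->; exact: mulrC.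
Qed.

Lemma unitmx_not_eigenvalue (F : fieldType) n (A : 'M[F]_n) (a : F) :
  ~~ eigenvalue A a -> A - a%:M \in unitmx.
Proof. by rewrite -row_free_unit -kermx_eq0 /eigenvalue negbK. Qed.

(** * Bordered matrices and graph patterns *)

Lemma nonzero_entries_bounded_below (R : realType) m n (A : 'M[R]_(m, n)) :
  exists2 eps, 0 < eps & forall i j, A i j != 0 -> eps <= `|A i j|.
Proof.
(* The default 1 keeps the bound positive when all entries vanish. *)
exists (\big[Num.min/1]_(p | A p.1 p.2 != 0) `|A p.1 p.2|).
  by apply: lt_bigmin => // p; rewrite normr_gt0.
by move=> i j Aij; exact: (bigmin_le_cond _ (j := (i, j))).
Qed.

Lemma col'_mulmx (R : pzRingType) n (y : 'rV[R]_n) (B : 'M[R]_n) (v : 'I_n) :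
  y 0 v = 0 -> col' v (y *m B) = col' v y *m row' v (col' v B).
Proof.
move=> yv; apply/rowP => j; rewrite !mxE (bigD1_ord v) //= yv mul0r add0r.
by apply: eq_bigr => k _; rewrite !mxE.
Qed.

Lemma del_rcE (R : realType) n (A : 'M[R]_n) (v : 'I_n) i j :
  del_rc A v i j = A (lift v i) (lift v j).
Proof. by rewrite !mxE. Qed.

Lemma row_eq0_col' (R : pzRingType) n (y : 'rV[R]_n) (v : 'I_n) :
  y 0 v = 0 -> col' v y = 0 -> y = 0.
Proof.
move=> yv /rowP y'; apply/rowP => j; rewrite mxE.
by case: (unliftP v j) => [k ->|->//]; have := y' k; rewrite !mxE.
Qed.

(* A kernel vector [(y, a)] has [y v = 0] if [delta = 0], so [y] restricted
   to the other coordinates is killed by the invertible [del_rc B v]. *)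
Lemma bordered_corner_neq0 (R : realType) n (B : 'M[R]_n) (v : 'I_n)
    (tau delta : R) (u : 'rV[R]_(n + 1)) :
  tau != 0 -> del_rc B v \in unitmx -> u != 0 ->
  u *m block_mx B (tau *: delta_mx v 0) (tau *: delta_mx 0 v) delta%:M = 0 ->
  delta != 0.
Proof.
move=> tau0 uB u0 uN; apply: contra_neq u0 => delta0.
move: uN; rewrite -[u]hsubmxK; set y := lsubmx u; set a := rsubmx u.
rewrite mul_row_block delta0 -(row_mx0 _ 1 n 1) => /eq_row_mx[e1 e2].
have yv : y 0 v = 0.
  move/rowP/(_ 0): e2; rewrite -scalemxAr -colE !mxE big1 ?addr0; last first.
    by move=> i _; rewrite !mxE mul0rn mulr0.
  by move/eqP; rewrite mulf_eq0 (negPf tau0) => /eqP.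
have y0 : y = 0.
  apply: (row_eq0_col' yv).
  rewrite -[LHS](mulmxK uB) -[X in X *m invmx _]/(col' v y *m row' v (col' v B)).
  rewrite -col'_mulmx //.
  suff -> : col' v (y *m B) = 0 by rewrite mul0mx.
  move/eqP: e1; rewrite addr_eq0 => /eqP ->.
  apply/rowP => j; rewrite !mxE big1 ?oppr0 // => i _.
  by rewrite !mxE [lift v j == v]eq_sym (negPf (neq_lift v j)) andbF !mulr0.
(* Once [y = 0], coordinate [v] of the first block equation says [a * tau = 0]. *)
move/rowP/(_ v): e1; rewrite y0 mul0mx add0r !mxE big_ord1 ?mxE !eqxx mulr1.
move/eqP; rewrite mulf_eq0 (negPf tau0) orbF => /eqP a0.
have -> : a = 0 by apply/rowP => i; rewrite ord1 !mxE; exact: a0.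
by rewrite row_mx0.
Qed.

Definition nonadjacent n (G : rel 'I_n) : rel 'I_n :=
  fun i j => (i != j) && ~~ G i j.

(* The pairs left free when a vertex is appended to [G]: all pairs joining the
   new vertex to an old one are included. *)
Definition bordered_pattern n (G : rel 'I_n) : rel 'I_(n + 1) :=
  fun x y => match fintype.split x, fintype.split y with
             | inl a, inl b => nonadjacent G a b
             | inr _, inr _ => false
             | _, _ => true
             end.

Lemma mxmask_bordered (R : realType) n (G : rel 'I_n) (X : 'M[R]_n) x y z :
  mxmask (bordered_pattern G) (block_mx X x y z)
  = block_mx (mxmask (nonadjacent G) X) x y 0.
Proof.
apply/matrixP => i j; rewrite !mxE /bordered_pattern.
by case: (fintype.split i) => k; rewrite !mxE; case: (fintype.split j) => l;
  rewrite ?mxE.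
Qed.

(** A matrix supported on non-edges has zero diagonal and zero entrywise product with [A]; scalar
    shifts do not affect commutation. *)
Lemma SSP_pattern_SSP (R : realType) n (G : rel 'I_n) (A : 'M[R]_n) (lambda : R) :
  in_SG G A -> SSP A -> pattern_SSP (nonadjacent G) (A - lambda%:M).
Proof.
move=> [At AG] Assp X Xt PX.
rewrite mulmxBl mulmxBr scalar_mxC => /(addIr _) AX.
have X0 i j : ~~ nonadjacent G i j -> X i j = 0.
  by move=> /negPf ij; rewrite -PX mxE ij.
apply: Assp; rewrite ?AX ?subrr //; apply/matrixP => i j; rewrite !mxE.
  have [-> | ij] := eqVneq i j; first by rewrite X0 ?mulr0 // /nonadjacent eqxx.
  have := AG i j ij; have [-> | _] := eqVneq (A i j) 0; first by rewrite mul0r.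
  by move=> /= Gij; rewrite X0 ?mulr0 // /nonadjacent -Gij andbF.
have [-> | ij] := eqVneq i j; first by rewrite X0 ?mulr0 // /nonadjacent eqxx.
by rewrite mul0r.
Qed.

Lemma mxmask_nonadjacent_in_SG (R : realType) n (G : rel 'I_n) (A : 'M[R]_n) :
  in_SG G A -> mxmask (nonadjacent G) A = 0.
Proof.
move=> [_ AG]; apply/matrixP => i j; rewrite !mxE /nonadjacent.
case: eqVneq => //= ij; rewrite -AG // negbK.
by case: eqP.
Qed.

(** The mask keeps non-edges at 0, and a perturbation smaller than every nonzero entry of [A] cannot
    cancel an edge. *)
Lemma in_SG_near (R : realType) n (G : rel 'I_n) (A : 'M[R]_n) : in_SG G A ->
  exists2 eps, 0 < eps & forall B : 'M[R]_n, B^T = B ->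
    mxmask (nonadjacent G) B = 0 -> `|B - A| < eps -> in_SG G B.
Proof.
move=> [At AG]; have [e e0 eA] := nonzero_entries_bounded_below A.
exists e => // B Bt PB BA; split=> // i j ij.
have /matrixP/(_ i j) := PB; rewrite !mxE /nonadjacent ij /= -AG // negbK.
have [_ -> | Aij _] := eqVneq (A i j) 0; first by rewrite eqxx.
apply/negP => /eqP Bij; have := mx_entry_le_norm (B - A) i j.
rewrite !mxE Bij add0r normrN => /(le_trans (eA i j Aij)) /le_lt_trans /(_ BA).
by rewrite ltxx.
Qed.

Lemma in_SG_shift (R : realType) n (G : rel 'I_n) (A : 'M[R]_n) (lambda : R) :
  in_SG G A -> in_SG G (A + lambda%:M).
Proof.
move=> [At AG]; split; first by rewrite /symmetric_mx linearD /= At tr_scalar_mx.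
by move=> i j ij; rewrite !mxE (negPf ij) addr0 AG.
Qed.

(** * Attaching one new vertex *)

Section Bordering.
Variables (R : realType) (n : nat) (G : rel 'I_n) (A0 : 'M[R]_n) (v : 'I_n).
Hypotheses (Gsym : forall i j, G i j = G j i) (A0G : in_SG G A0).
Hypothesis A0ssp : pattern_SSP (nonadjacent G) A0.
Hypotheses (uA0 : A0 \in unitmx) (uA0v : del_rc A0 v \in unitmx).

Let M : 'M[R]_(n + 1) := block_mx A0 0 0 0.

Lemma bordered_pattern_sym i j :
  bordered_pattern G i j = bordered_pattern G j i.
Proof.
rewrite /bordered_pattern; case: (fintype.split i) => k; case: (fintype.split j) => l //.
by rewrite /nonadjacent eq_sym Gsym.
Qed.

(** For a commuting [X] the border [x] satisfies [A0 x = 0], so it vanishes by invertibility; the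
    corner is 0 by the pattern, and the main block by [A0ssp]. *)
Lemma direct_sum_zero_SSP : pattern_SSP (bordered_pattern G) M.
Proof.
move=> X Xt PX; move: Xt PX; rewrite -[X]submxK.
set X1 := ulsubmx X; set x := ursubmx X; set y := dlsubmx X.
rewrite tr_block_mx mxmask_bordered => /eq_block_mx[X1t _ yx _] /eq_block_mx[PX _ _ <-].
rewrite !mulmx_block !mulmx0 !mul0mx !addr0 => /eq_block_mx[AX Ax _ _].
have x0 : x = 0 by rewrite -[x](mulKmx uA0) Ax mulmx0.
rewrite -yx x0 trmx0 (A0ssp X1t PX AX).
by rewrite /block_mx !row_mx0 col_mx0.
Qed.

Lemma bordered_isospectral eps : 0 < eps ->
  exists (B : 'M[R]_n) (tau delta : R) (Q : 'M[R]_(n + 1)),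
  let N := block_mx B (tau *: delta_mx v 0) (tau *: delta_mx 0 v) delta%:M in
  [/\ Q^T *m Q = 1%:M, N = Q *m M *m Q^T & pattern_SSP (bordered_pattern G) N]
  /\ [/\ in_SG G B, B \in unitmx, `|B - A0| < eps, 0 < tau < eps &
      (delta != 0) && (`|delta| < eps)].
Proof.
move=> eps0; have [A0t _] := A0G.
have [e1 e1_gt0 near_SG] := in_SG_near A0G.
have [e2 e2_gt0 near_u] := unitmx_near uA0.
have [e3 e3_gt0 near_uv] := unitmx_near uA0v.
pose e := Num.min (Num.min e1 e2) (Num.min e3 eps).
have e_gt0 : 0 < e by rewrite !lt_min e1_gt0 e2_gt0 e3_gt0.
have Mt : M^T = M by rewrite tr_block_mx A0t !trmx0.
have [d d0 perturb] :=
  isospectral_perturbation bordered_pattern_sym Mt direct_sum_zero_SSP e_gt0.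
pose tau := Num.min d eps / 2.
have m0 : 0 < Num.min d eps by rewrite lt_min d0.
have tau0 : 0 < tau by rewrite divr_gt0.
have taum : tau < Num.min d eps by rewrite /tau; lra.
(* The prescribed change: only the border moves, to [tau e_v], while non-edges of [G] stay 0. The
   corner is outside the pattern and remains uncontrolled. *)
pose D : 'M[R]_(n + 1) := block_mx 0 (tau *: delta_mx v 0) (tau *: delta_mx 0 v) 0.
have Dt : D^T = D.
  by rewrite tr_block_mx !trmx0 ![(_ *: _)^T]linearZ /= !trmx_delta.
have PD : mxmask (bordered_pattern G) D = D by rewrite mxmask_bordered linear0.
have Dd : `|D| < d.
  have bd (b : bool) : `|tau * b%:R| < d.
    case: b; rewrite ?mulr0 ?normr0 // mulr1 gtr0_norm //.
    by rewrite (lt_le_trans taum) // ge_min lexx.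
  apply: mx_norm_lt => // i j; rewrite mxE.
  by case: (fintype.split i) => k; rewrite mxE; case: (fintype.split j) => l;
    rewrite !mxE ?normr0 // bd.
have [Q [QQ QM PQ Qssp]] := perturb D Dt PD Dd.
set N := Q *m M *m Q^T in QM PQ Qssp.
have Nt : N^T = N by rewrite /N !trmx_mul trmxK Mt mulmxA.
pose B := ulsubmx N; pose delta := drsubmx N 0 0.
have NE : N = block_mx B (tau *: delta_mx v 0) (tau *: delta_mx 0 v) delta%:M.
  rewrite -[N]submxK -/B [drsubmx N]mx11_scalar -/delta.
  move: PQ; rewrite -[N in mxmask _ N]submxK !mxmask_bordered.
  rewrite (mxmask_nonadjacent_in_SG A0G).
  by rewrite add_block_mx !add0r => /eq_block_mx[_ -> -> _].
have PB : mxmask (nonadjacent G) B = 0.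
  move: PQ; rewrite {1}NE !mxmask_bordered (mxmask_nonadjacent_in_SG A0G).
  by rewrite add_block_mx !add0r => /eq_block_mx[].
have Bt : B^T = B by rewrite /B trmx_ulsub Nt.
have BA : `|B - A0| < e.
  apply: mx_norm_lt => // i j; apply: le_lt_trans QM.
  have -> : (B - A0) i j = (N - M) (lshift 1 i) (lshift 1 j).
    have -> : B - A0 = ulsubmx (N - M).
      by rewrite /ulsubmx !linearB /= -!/(ulsubmx _) block_mxKul.
    by rewrite !mxE.
  exact: mx_entry_le_norm.
have lt_e e' : e <= e' -> `|B - A0| < e' by exact: lt_le_trans.
have le1 : e <= e1 by rewrite !ge_min lexx.
have le2 : e <= e2 by rewrite !ge_min lexx orbT.
have le3 : e <= e3 by rewrite !ge_min lexx !orbT.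
have le4 : e <= eps by rewrite !ge_min lexx !orbT.
have BE : B = A0 + (B - A0) by rewrite addrC subrK.
have uBv : del_rc B v \in unitmx.
  have -> : del_rc B v = del_rc A0 v + del_rc (B - A0) v.
    by apply/matrixP => i j; rewrite !mxE; ring.
  apply: near_uv; apply: mx_norm_lt => // i j.
  by rewrite del_rcE (le_lt_trans (mx_entry_le_norm _ _ _)) // lt_e.
exists B, tau, delta, Q => /=; rewrite -NE; split; split=> //.
- by apply: near_SG => //; exact: lt_e.
- by rewrite BE near_u // lt_e.
- by rewrite lt_e.
- by rewrite tau0 (lt_le_trans taum) // ge_min lexx orbT.
apply/andP; split.
  (* The last unit row is killed by [M], so its image under [Q^T] is a nonzero kernel row of
     [N = Q M Q^T]. *)
  pose u : 'rV[R]_(n + 1) := row_mx 0 1%:M *m Q^T.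
  apply: (@bordered_corner_neq0 _ _ B v tau delta u) => //; first by rewrite gt_eqF.
    apply/eqP => u0; have : u *m Q = 0 by rewrite u0 mul0mx.
    rewrite /u -mulmxA QQ mulmx1 => /matrixP/(_ 0 (rshift n 0)).
    by rewrite row_mxEr !mxE eqxx => /eqP; rewrite oner_eq0.
  rewrite -NE /N /u !mulmxA -(mulmxA _ Q^T) QQ mulmx1.
  by rewrite mul_row_block !mulmx0 !mul0mx !addr0 row_mx0 mul0mx.
apply: lt_le_trans le4; apply: le_lt_trans QM.
have -> : delta = (N - M) (rshift n 0) (rshift n 0).
  have -> : delta = drsubmx (N - M) 0 0.
    by rewrite /drsubmx !linearB /= -!/(drsubmx _) block_mxKdr subr0.
  by rewrite !mxE.
exact: mx_entry_le_norm.
Qed.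

End Bordering.

(** * Spreading the new vertex over a clique *)

Lemma unit_vector_no_zero (R : realType) s : (0 < s)%N ->
  exists2 c : 'cV[R]_s, c^T *m c = 1%:M & forall k, (c k 0 != 0) && (`|c k 0| <= 1).
Proof.
move=> s0; exists (const_mx (Num.sqrt s%:R)^-1).
  apply/matrixP => i j; rewrite !ord1 !mxE /=.
  under eq_bigr do rewrite !mxE.
  rewrite sumr_const card_ord -expr2 exprVn sqr_sqrtr // -[LHS]mulr_natr.
  by rewrite mulVf // pnatr_eq0 -lt0n.
have s1 : 1 <= Num.sqrt s%:R :> R by rewrite -{1}sqrtr1 ler_sqrt // ler1n.
move=> k; rewrite mxE invr_eq0 gt_eqF ?(lt_le_trans ltr01) //=.
by rewrite ger0_norm ?invr_ge0 // invf_le1 // (lt_le_trans ltr01).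
Qed.

Section BlowUp.
Variables (R : realType) (n s : nat) (G : rel 'I_n) (v : 'I_n).
Variables (B : 'M[R]_n) (tau delta : R) (c : 'cV[R]_s).
Hypotheses (BG : in_SG G B) (tau0 : tau != 0) (delta0 : delta != 0).
Hypotheses (cc : c^T *m c = 1%:M) (c0 : forall k, c k 0 != 0).

Let N := block_mx B (tau *: delta_mx v 0) (tau *: delta_mx 0 v) (delta%:M : 'M_1).
Let C : 'M[R]_(n + s, n + 1) := block_mx 1%:M 0 0 c.
Let N' : 'M[R]_(n + s) := C *m N *m C^T.

Lemma blow_up_isometry : C^T *m C = 1%:M.
Proof.
rewrite /C tr_block_mx !trmx0 trmx1 mulmx_block !mulmx0 !mul0mx !addr0 !add0r.
by rewrite mul1mx cc -scalar_mx_block.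
Qed.

Lemma blow_upE : N' = block_mx B (tau *: (delta_mx v 0 *m c^T))
  (tau *: (c *m delta_mx 0 v)) (delta *: (c *m c^T)).
Proof.
rewrite /N' /C /N tr_block_mx !trmx0 trmx1 !mulmx_block.
rewrite !mulmx0 !mul0mx !addr0 !add0r !mul1mx !mulmx1.
by rewrite -scalemxAl -scalemxAr mul_mx_scalar -scalemxAl.
Qed.

Lemma blow_up_entries i j : N' i j =
  match fintype.split i, fintype.split j with
  | inl a, inl b => B a b
  | inl a, inr l => tau * (c l 0 *+ (a == v))
  | inr k, inl b => tau * (c k 0 *+ (b == v))
  | inr k, inr l => delta * (c k 0 * c l 0)
  end.
Proof.
rewrite blow_upE mxE; case: (fintype.split i) => k; rewrite mxE;
  case: (fintype.split j) => l //; rewrite !mxE big_ord1 !mxE ?eqxx ?andbT //.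
- by rewrite mulr_natl.
- by rewrite mulr_natr.
Qed.

Lemma blow_up_tr : N'^T = N'.
Proof.
have [Bt _] := BG; apply/matrixP => i j; rewrite mxE !blow_up_entries.
case: (fintype.split i) => k; case: (fintype.split j) => l //.
  by rewrite -[in LHS]Bt mxE.
by rewrite [c l 0 * _]mulrC.
Qed.

Lemma blow_up_in_SG : in_SG (vertex_sum_K s G v) N'.
Proof.
split; first exact: blow_up_tr.
have [_ BG'] := BG.
move=> i j ij; rewrite blow_up_entries /vertex_sum_K.
have inj : fintype.split i != fintype.split j.
  by apply: contra_neq ij => /(congr1 (@unsplit _ _)); rewrite !splitK.
move: inj; case: (fintype.split i) => k; case: (fintype.split j) => l kl.
- by apply: BG'; apply: contra_neq kl => ->.
- by rewrite mulf_eq0 (negPf tau0) /=; case: (k == v); rewrite ?c0 ?eqxx.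
- by rewrite mulf_eq0 (negPf tau0) /=; case: (l == v); rewrite ?c0 ?eqxx.
- rewrite !mulf_eq0 (negPf delta0) !(negPf (c0 _)) /=.
  by apply/esym; apply: contra_neq kl => ->.
Qed.

(* Compressing a matrix [X] commuting with [N'] by the isometry [C] gives one
   commuting with [N], and its off-diagonal block determines that of [X] through [B]. *)
Lemma blow_up_SSP (lambda : R) : B \in unitmx ->
  pattern_SSP (bordered_pattern G) N -> SSP (N' + lambda%:M).
Proof.
move=> uB Nssp X Xt NX IX; rewrite mulmxDl mulmxDr scalar_mxC.
rewrite opprD addrACA subrr addr0 => /subr0_eq comm.
have [_ N'G] := blow_up_in_SG.
have X0 i j : (i == j) || vertex_sum_K s G v i j -> X i j = 0.
  have [<- _ | ij /= Gij] := eqVneq i j.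
    by have /matrixP/(_ i i) := IX; rewrite !mxE eqxx mul1r.
  have := N'G i j ij; rewrite Gij => N0.
  have /matrixP/(_ i j) := NX.
  rewrite mxE [X in X * _]mxE [X in _ + X]mxE (negPf ij) addr0 [RHS]mxE => /eqP.
  by rewrite mulf_eq0 (negPf N0) => /eqP.
pose X1 := ulsubmx X; pose X2 := ursubmx X.
(* The new vertices are pairwise adjacent, so the lower right block of [X] is 0. *)
have XE : X = block_mx X1 X2 X2^T 0.
  rewrite -{1}[X]submxK; congr block_mx; first by rewrite /X2 trmx_ursub Xt.
  apply/matrixP => k l.
  have -> : drsubmx X k l = X (rshift n k) (rshift n l) by rewrite !mxE.
  rewrite X0 ?mxE // eq_rshift /vertex_sum_K.
  by rewrite -![rshift n _]/(unsplit (inr _)) !unsplitK orbN.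
have X1t : X1^T = X1 by rewrite /X1 trmx_ulsub Xt.
have PX1 : mxmask (nonadjacent G) X1 = X1.
  apply/matrixP => k l; rewrite mxE; case: ifPn => // kl.
  have -> : X1 k l = X (lshift s k) (lshift s l) by rewrite !mxE.
  rewrite X0 // eq_lshift /vertex_sum_K.
  rewrite -![lshift s _]/(unsplit (inl _)) !unsplitK.
  by move: kl; rewrite /nonadjacent negb_and !negbK.
have CC := blow_up_isometry.
have YE : C^T *m X *m C = block_mx X1 (X2 *m c) (c^T *m X2^T) 0.
  rewrite {1}XE /C tr_block_mx !trmx0 trmx1 !mulmx_block.
  by rewrite !(mulmx0, mul0mx, addr0, add0r, mul1mx, mulmx1).
have Y0 : C^T *m X *m C = 0.
  apply: Nssp.
  - by rewrite !trmx_mul trmxK Xt mulmxA.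
  - by rewrite YE mxmask_bordered PX1.
  - transitivity (C^T *m (N' *m X) *m C).
      by rewrite /N' !mulmxA CC mul1mx.
    by rewrite comm /N' -!mulmxA CC mulmx1.
move: Y0; rewrite YE -(block_mx0 R n 1 n 1) => /eq_block_mx[X10 X2c _ _].
move: comm; rewrite XE X10 blow_upE !mulmx_block => /eq_block_mx[_ + _ _].
(* The upper right block of the commutation reads [B X2 = delta X2 c c^T], whose right side vanishes
   since [X2 c = 0]. *)
rewrite mulmx0 mul0mx addr0 add0r -scalemxAr mulmxA X2c mul0mx scaler0 => BX2.
have X20 : X2 = 0 by rewrite -[X2](mulKmx uB) BX2 mulmx0.
by rewrite X20 trmx0 block_mx0.
Qed.

End BlowUp.

(** * Assembly for an arbitrary number of new vertices *)

Theorem theorem3p6 (R : realType) (n : nat) (G : rel 'I_n) (A : 'M[R]_n)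
    (v : 'I_n) (lambda : R) :
  simple_graph G -> in_SG G A -> SSP A ->
  ~~ eigenvalue A lambda -> ~~ eigenvalue (del_rc A v) lambda ->
  forall s : nat, (0 < s)%N ->
  forall eps : R, 0 < eps ->
  exists A' : 'M[R]_(n + s),
    [/\ in_SG (vertex_sum_K s G v) A',
        SSP A',
        char_poly A' = char_poly A * ('X - lambda%:P) ^+ s,
        (forall i j, `|A' i j - block_mx A 0 0 (lambda%:M) i j| < eps) &
        (forall k : 'I_s, A' (rshift n k) (rshift n k) != lambda)].
Proof.
move=> [Gsym _] AG Assp lamA lamAv s s0 eps eps0.
set A0 := A - lambda%:M.
have A0G : in_SG G A0 by rewrite /A0 -raddfN; exact: in_SG_shift.
have uA0 : A0 \in unitmx by exact: unitmx_not_eigenvalue.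
have uA0v : del_rc A0 v \in unitmx.
  have -> : del_rc A0 v = del_rc A v - lambda%:M.
    by apply/matrixP => i j; rewrite !mxE (inj_eq lift_inj).
  exact: unitmx_not_eigenvalue.
have A0ssp := SSP_pattern_SSP (lambda := lambda) AG Assp.
have [B [tau [delta [Q [[QQ NE Nssp]]]]]] :=
  bordered_isospectral Gsym A0G A0ssp uA0 uA0v eps0.
move=> [BG uB BA /andP[tau_gt0 tau_lt] /andP[delta0 delta_lt]].
have tau0 : tau != 0 by rewrite gt_eqF.
have [c cc cP] := @unit_vector_no_zero R s s0.
have c0 k : c k 0 != 0 by have /andP[] := cP k.
have c1 k : `|c k 0| <= 1 by have /andP[] := cP k.
set N := block_mx B _ _ _ in NE Nssp.
pose C : 'M[R]_(n + s, n + 1) := block_mx 1%:M 0 0 c.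
have CC : C^T *m C = 1%:M := @blow_up_isometry R n s c cc.
have entries := @blow_up_entries R n s v B tau delta c.
rewrite -/N -/C in entries.
exists (C *m N *m C^T + lambda%:M); split.
- exact/in_SG_shift/blow_up_in_SG.
- exact: (blow_up_SSP (G := G)).
(* [A0 (+) 0] is [J A0 J^T] for the coordinate inclusion [J], so [V = C Q J] is an isometry carrying
   [A0] to [C N C^T]. *)
- pose V : 'M[R]_(n + s, n) := C *m Q *m col_mx 1%:M 0.
  have -> : C *m N *m C^T = V *m A0 *m V^T.
    rewrite NE (_ : block_mx A0 0 0 0 = col_mx 1%:M 0 *m A0 *m (col_mx 1%:M 0)^T).
      by rewrite /V !trmx_mul !mulmxA.
    by rewrite tr_col_mx trmx1 trmx0 mul_col_mx mul1mx mul0mx mul_col_row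
       mulmx1 !mulmx0 ?mul0mx.
  apply: char_poly_isometry.
  rewrite /V !trmx_mul -!mulmxA (mulmxA C^T) CC mul1mx (mulmxA Q^T) QQ mul1mx.
  by rewrite tr_col_mx trmx1 trmx0 mul_row_col mul1mx mul0mx addr0.
- have -> : block_mx A 0 0 lambda%:M = block_mx A0 0 0 0 + lambda%:M :> 'M_(n + s).
    by rewrite scalar_mx_block add_block_mx !addr0 add0r subrK.
  (* Entries of [c] are at most 1 in absolute value, so spreading does not enlarge [tau] or
     [delta]. *)
  have tauc (b : bool) k : `|tau * (c k 0 *+ b)| < eps.
    case: b; last by rewrite mulr0 normr0.
    apply: le_lt_trans tau_lt; rewrite normrM gtr0_norm //.
    by apply: ler_piMr; [exact: ltW | exact: c1].
  move=> i j; rewrite [(_ + lambda%:M) i j]mxE [(block_mx _ _ _ _ + _) i j]mxE.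
  rewrite opprD addrACA subrr addr0 entries [block_mx _ _ _ _ i j]mxE.
  case: (fintype.split i) => k; rewrite mxE; case: (fintype.split j) => l.
  + apply: le_lt_trans BA; have -> : B k l - A0 k l = (B - A0) k l by rewrite !mxE.
    exact: mx_entry_le_norm.
  + by rewrite mxE subr0.
  + by rewrite mxE subr0.
  + rewrite mxE subr0; apply: le_lt_trans delta_lt; rewrite !normrM ler_piMr //.
    by rewrite mulr_ile1.
(* This diagonal entry minus [lambda] is [delta * c_k ^ 2]. *)
- move=> k; rewrite mxE entries [lambda%:M _ _]mxE eqxx.
  rewrite -[rshift n k]/(unsplit (inr k)) unsplitK -subr_eq0 addrK.
  by rewrite !mulf_neq0.
Qed.
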